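(* Let $X$ be a set with $|X|=6$. Every graph on $X$ is $\sim$-equivalent to one of the following sixteen graphs on $X$: (1) $K_6$; (2) $N_6$; (3) $L_2^6$ (a single edge and four isolated vertices); (4) $\varkappa(L_2^6)$ (the complete graph minus one edge); (5) $(L_2\dot\cup L_2)^6$ (two disjoint edges and two isolated vertices); (6) $C_5^6$; (7) $L_3^6$; (8) $K_3^6$; (9) $(L_3\dot\cup L_2)^6$; (10) $L_4^6$; (11) $L_3\dot\cup L_3$; (12) $\varkappa(L_3^6)$; (13) $C_4^6$; (14) $L_5^6$; (15) $L_6$; (16) $C_6$. Moreover, no two graphs in this list are $\sim$-equivalent. (Consequently there are exactly 16 $\sim$-classes of graphs on 6 vertices.)
   Context: A graph on a finite set $X$ is a pair $\langle X,\mathcal E\rangle$ with $\mathcal E$ a set of 2-element subsets of $X$ (simple, undirected, loopless). For graphs $G_1=\langle X,\mathcal E_1\rangle$, $G_2=\langle X,\mathcal E_2\rangle$ on the same set, $G_1\triangle G_2=\langle X,\mathcal E_1\triangle\mathcal E_2\rangle$ (symmetric difference of edge sets). For $A\subseteq X$, $K_{A,X\setminus A}$ denotes the graph on $X$ whose edges are all $\{a,b\}$ with $a\in A$, $b\in X\setminus A$ (for $A=\emptyset$ this is the edgeless graph). Write $G_1\approx G_2$ iff $G_1\triangle G_2=K_{A,X\setminus A}$ for some $A\subseteq X$, and $G_1\sim G_2$ iff there is a graph $G_3$ on $X$ with $G_1\approx G_3$ and $G_3$ isomorphic to $G_2$. $\varkappa(G)$ is the complement graph $\langle X, \{\text{all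 2-subsets}\}\setminus\mathcal E\rangle$. $K_n$, $N_n$, $C_n$, $L_n$ denote the complete graph, the edgeless graph, the cycle, and the path on $n$ vertices ($L_n$ has $n-1$ edges); $\dot\cup$ is disjoint union of graphs; for a graph $H$ on $k$ vertices, $H^n=H\dot\cup N_{n-k}$ ($H$ together with $n-k$ isolated vertices). A listed graph stands for any graph on $X$ isomorphic to it (the choice does not affect $\sim$-classes). *)

(* Defs.v *)
From HB Require Import structures.
From mathcomp Require Import all_boot.

Set Implicit Arguments.
Unset Strict Implicit.
Unset Printing Implicit Defensive.

Record graph (X : finType) := Graph {
  edges : {set {set X}};
  _ : [forall e in edges, #|e| == 2]
}.

HB.instance Definition _ (X : finType) := [isSub for @edges X].
HB.instance Definition _ (X : finType) := [Finite of graph X by <:].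

Lemma edges_card2 (X : finType) (G : graph X) (e : {set X}) :
  e \in edges G -> #|e| == 2.
Proof. by case: G => E /= /forall_inP h /h. Qed.

Lemma symdiff_subproof (X : finType) (G1 G2 : graph X) :
  [forall e in (edges G1 :\: edges G2) :|: (edges G2 :\: edges G1), #|e| == 2].
Proof.
by apply/forall_inP => e; rewrite !inE => /orP[] /andP[_] /edges_card2.
Qed.

Definition symdiff (X : finType) (G1 G2 : graph X) : graph X :=
  Graph (symdiff_subproof G1 G2).

Lemma complete_bipartite_subproof (X : finType) (A : {set X}) :
  [forall e in [set [set a; b] | a in A, b in ~: A], #|e| == 2].
Proof.
apply/forall_inP => e /imset2P[a b aA bA ->]; rewrite inE in bA.
rewrite cards2; have [ab|//] := eqVneq a b.
by rewrite -ab aA in bA.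
Qed.

Definition complete_bipartite (X : finType) (A : {set X}) : graph X :=
  Graph (complete_bipartite_subproof A).

(* The relation written $\approx$. *)
Definition approx (X : finType) (G1 G2 : graph X) : Prop :=
  exists A : {set X}, symdiff G1 G2 = complete_bipartite A.

Definition isomorphic (X Y : finType) (G : graph X) (H : graph Y) : Prop :=
  exists f : X -> Y, bijective f /\
    forall x y : X, ([set f x; f y] \in edges H) = ([set x; y] \in edges G).

(* The relation written $\sim$. *)
Definition sim (X : finType) (G1 G2 : graph X) : Prop :=
  exists G3 : graph X, approx G1 G3 /\ isomorphic G3 G2.

Lemma compl_subproof (X : finType) (G : graph X) :
  [forall e in [set e : {set X} | #|e| == 2] :\: edges G, #|e| == 2].
Proof. by apply/forall_inP => e; rewrite !inE => /andP[]. Qed.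

Definition compl (X : finType) (G : graph X) : graph X :=
  Graph (compl_subproof G).

Lemma empty_graph_subproof (n : nat) :
  [forall e in (set0 : {set {set 'I_n}}), #|e| == 2].
Proof. by apply/forall_inP => e; rewrite inE. Qed.

Definition empty_graph (n : nat) : graph 'I_n := Graph (empty_graph_subproof n).

Lemma complete_graph_subproof (n : nat) :
  [forall e in [set e : {set 'I_n} | #|e| == 2], #|e| == 2].
Proof. by apply/forall_inP => e; rewrite inE. Qed.

Definition complete_graph (n : nat) : graph 'I_n :=
  Graph (complete_graph_subproof n).

Lemma path_graph_subproof (n : nat) :
  [forall e in [set e : {set 'I_n} | [exists i : 'I_n, exists j : 'I_n,
                  (j == i.+1 :> nat) && (e == [set i; j])]], #|e| == 2].
Proof.
apply/forall_inP => e; rewrite inE => /existsP[i] /existsP[j] /andP[/eqP ij /eqP ->].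
rewrite cards2; have [eij|//] := eqVneq i j.
by move: ij; rewrite eij => /n_Sn.
Qed.

Definition path_graph (n : nat) : graph 'I_n := Graph (path_graph_subproof n).

Lemma cycle_graph_subproof (n : nat) :
  [forall e in [set [set i; ordS i] | i : 'I_n & i != ordS i], #|e| == 2].
Proof.
by apply/forall_inP => e /imsetP[i]; rewrite inE => ni ->; rewrite cards2 ni.
Qed.

(* [ordS] is the successor modulo [n], so this is the $n$-cycle for $n \ge 3$;
   the condition [i != ordS i] only excludes the loop that would arise for
   $n = 1$. *)
Definition cycle_graph (n : nat) : graph 'I_n := Graph (cycle_graph_subproof n).

Lemma disjoint_union_subproof (m n : nat) (G : graph 'I_m) (H : graph 'I_n) :
  [forall e in [set @lshift m n @: e | e : {set 'I_m} in edges G] :|: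
               [set @rshift m n @: e | e : {set 'I_n} in edges H], #|e| == 2].
Proof.
apply/forall_inP => e; rewrite inE => /orP[] /imsetP[e' e'E ->].
  by rewrite card_imset ?(edges_card2 e'E) //; apply: lshift_inj.
by rewrite card_imset ?(edges_card2 e'E) //; apply: rshift_inj.
Qed.

Definition disjoint_union (m n : nat) (G : graph 'I_m) (H : graph 'I_n) :
    graph 'I_(m + n) :=
  Graph (disjoint_union_subproof G H).

(* The graph $H^n$, for $k \le n$ where $k$ is the number of vertices of $H$. *)
Definition pad (n k : nat) (H : graph 'I_k) : graph 'I_(k + (n - k)) :=
  disjoint_union H (empty_graph (n - k)).

(* For the numerals below, [k + (6 - k)] is convertible to [6]. *)
Definition listed_graphs : 16.-tuple (graph 'I_6) :=
  [tuple of [:: complete_graph 6;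
                empty_graph 6;
                pad 6 (path_graph 2);
                compl (pad 6 (path_graph 2));
                pad 6 (disjoint_union (path_graph 2) (path_graph 2));
                pad 6 (cycle_graph 5);
                pad 6 (path_graph 3);
                pad 6 (complete_graph 3);
                pad 6 (disjoint_union (path_graph 3) (path_graph 2));
                pad 6 (path_graph 4);
                disjoint_union (path_graph 3) (path_graph 3);
                compl (pad 6 (path_graph 3));
                pad 6 (cycle_graph 4);
                pad 6 (path_graph 5);
                path_graph 6;
                cycle_graph 6]].

(* Main.v *)
(** Switching with respect to [A] adds [(x \in A) (+) (y \in A)] to the
    adjacency of [x] and [y], and this cancels in the parity of the number of
    edges spanned by a triple of vertices. Conversely, the parities of the
    triples through one fixed vertex determine the graph up to switching. Hence
    a switching class on six labelled vertices amounts to ten bits, and the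
    classes of the relation [sim] are the orbits of the symmetric group on these
    1024 codes. Enumerating the orbits of the sixteen listed graphs shows that
    they are pairwise disjoint and cover all codes. *)
Require Import Defs.
From mathcomp Require Import all_boot.

Set Implicit Arguments.
Unset Strict Implicit.
Unset Printing Implicit Defensive.

(** * Graphs as adjacency relations *)

Lemma eq_set2 (T : finType) (x y u v : T) :
  [set x; y] = [set u; v] -> (x = u /\ y = v) \/ (x = v /\ y = u).
Proof.
move=> e.
have := set21 u v; have := set22 u v; rewrite -e !inE.
have := set21 x y; have := set22 x y; rewrite e !inE.
by do 4![case/orP=> /eqP ?]; subst; auto.
Qed.

Definition adj (X : finType) (G : graph X) : rel X :=
  fun x y => [set x; y] \in edges G.

Section Adjacency.
Variable X : finType.
Implicit Types (G H : graph X) (A : {set X}).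

Lemma adjC G : symmetric (adj G).
Proof. by move=> x y; rewrite /adj setUC. Qed.

Lemma adjxx G x : adj G x x = false.
Proof. by apply/negP => /edges_card2; rewrite cards2 eqxx. Qed.

Lemma adj_inj G H : adj G =2 adj H -> G = H.
Proof.
move=> GH; apply/val_inj/setP => e /=.
have [/cards2P[x [y [_ ->]]]|en] := boolP (#|e| == 2); first exact: GH.
have nE (K : graph X) : (e \in edges K) = false.
  by apply: contraNF en => /edges_card2.
by rewrite !nE.
Qed.

Lemma adj_symdiff G H x y : adj (symdiff G H) x y = adj G x y (+) adj H x y.
Proof. by rewrite /adj /= !inE; do 2 case: (_ \in edges _). Qed.

Lemma adj_complete_bipartite A x y :
  adj (complete_bipartite A) x y = (x \in A) (+) (y \in A).
Proof.
apply/imset2P/idP => [[a b aA]|]; last first.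
  case xA: (x \in A); case yA: (y \in A) => // _; first by exists x y; rewrite ?inE ?yA.
  by exists y x; rewrite ?inE ?xA // setUC.
by rewrite inE => /negbTE bA /eq_set2[[-> ->]|[-> ->]]; rewrite aA bA.
Qed.

Lemma adj_compl G x y : adj (compl G) x y = (x != y) && ~~ adj G x y.
Proof. by rewrite /adj /= !inE andbC cards2; case: (x == y). Qed.

End Adjacency.

(** * Switching combined with isomorphism *)

(** This form of [sim] eliminates the intermediate graph and allows two different vertex sets, so
    that graphs on [X] can be compared with graphs on ['I_6]. *)
Definition switch_iso (X Y : finType) (G : graph X) (H : graph Y) :=
  exists f : X -> Y, bijective f /\ exists A : {set X},
    forall x y, adj H (f x) (f y) = adj G x y (+) ((x \in A) (+) (y \in A)).

Lemma simE (X : finType) (G H : graph X) : sim G H <-> switch_iso G H.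
Proof.
split=> [[G3 [[A GA] [f [bf fP]]]]|[f [bf [A fP]]]].
  exists f; split=> //; exists A => x y; rewrite [LHS]fP -/(adj G3 x y).
  by rewrite -adj_complete_bipartite -GA adj_symdiff addKb.
exists (symdiff G (complete_bipartite A)); split.
  by exists A; apply: adj_inj => x y; rewrite !adj_symdiff addKb.
exists f; split=> // x y; rewrite -/(adj H _ _) -/(adj (symdiff _ _) _ _).
by rewrite fP adj_symdiff adj_complete_bipartite.
Qed.

Lemma isomorphic_switch_iso (X Y : finType) (G : graph X) (H : graph Y) :
  isomorphic G H -> switch_iso G H.
Proof.
case=> f [bf fP]; exists f; split=> //; exists set0 => x y.
by rewrite !in_set0 !addbF; apply: fP.
Qed.

Lemma switch_iso_refl (X : finType) (G : graph X) : switch_iso G G.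
Proof.
by apply: isomorphic_switch_iso; exists id; split=> //; exists id.
Qed.

Lemma switch_iso_sym (X Y : finType) (G : graph X) (H : graph Y) :
  switch_iso G H -> switch_iso H G.
Proof.
case=> f [[g fK gK] [A fP]]; exists g; split; first by exists f.
exists (g @^-1: A) => x y; rewrite !inE.
by rewrite -[in adj H x y](gK x) -[in adj H _ y](gK y) fP addbK.
Qed.

Lemma switch_iso_trans (X Y Z : finType)
    (G : graph X) (H : graph Y) (K : graph Z) :
  switch_iso G H -> switch_iso H K -> switch_iso G K.
Proof.
case=> f [bf [A fP]] [g [bg [B gP]]].
exists (g \o f); split; first exact: bij_comp.
(* Switchings compose by symmetric difference, once [B] is pulled back along [f]. *)
exists [set x | (x \in A) (+) (f x \in B)] => x y /=.
rewrite gP fP !inE -!addbA; congr (_ (+) _).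
by rewrite (addbCA (y \in A)).
Qed.

Lemma isomorphic_pullback (X Y : finType) (h : X -> Y) (H : graph Y) :
  bijective h -> exists G : graph X, isomorphic G H.
Proof.
move=> bh; have hi := bij_inj bh.
have E2 : [forall e in [set e : {set X} | h @: e \in edges H], #|e| == 2].
  by apply/forall_inP => e; rewrite inE => /edges_card2; rewrite card_imset.
exists (Graph E2), h; split=> // x y.
by rewrite inE imsetU !imset_set1.
Qed.

(** * Parities of triples as switching invariants *)

Definition triple (T : Type) (a : rel T) x y z := a x y (+) a x z (+) a y z.

Lemma triple_switch (X Y : finType) (G : graph X) (H : graph Y) (f : X -> Y) :
  (exists A : {set X},
     forall x y, adj H (f x) (f y) = adj G x y (+) ((x \in A) (+) (y \in A))) ->
  forall x y z, triple (adj H) (f x) (f y) (f z) = triple (adj G) x y z.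
Proof.
case=> A fP x y z; rewrite /triple !fP.
by case: (x \in A); case: (y \in A); case: (z \in A);
   case: (adj G x y); case: (adj G x z); case: (adj G y z).
Qed.

(** Switch at the vertices whose adjacency to [z] differs between [G] and [H] along [f]. The parity
    equation for [x], [y], [z] then becomes the switching equation for [x] and [y]. *)
Lemma switch_of_triple (X Y : finType) (G : graph X) (H : graph Y)
    (f : X -> Y) (z : X) :
  (forall x y, triple (adj H) (f x) (f y) (f z) = triple (adj G) x y z) ->
  exists A : {set X},
    forall x y, adj H (f x) (f y) = adj G x y (+) ((x \in A) (+) (y \in A)).
Proof.
move=> fP; exists [set x | adj G x z (+) adj H (f x) (f z)] => x y.
move: (fP x y); rewrite /triple !inE.
by case: (adj G x z); case: (adj G y z); case: (adj G x y);
   case: (adj H (f x) (f z)); case: (adj H (f y) (f z)); case: (adj H (f x) _).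
Qed.

(** * Computable models of the listed graphs *)

Section SmallGraphs.
Variables (m n : nat).
Implicit Types (a b : rel nat).

(** Boolean relations on [nat] evaluate directly under [vm_compute], which makes them suitable
    stand-ins for edge sets in the enumeration. *)
Definition represents k (G : graph 'I_k) a :=
  forall i j : 'I_k, adj G i j = a i j.

Definition empty_rel : rel nat := fun _ _ => false.
Definition complete_rel : rel nat := fun i j => i != j.
Definition path_rel : rel nat := fun i j => (j == i.+1) || (i == j.+1).
Definition cycle_rel k : rel nat :=
  fun i j => (i != j) && ((j == i.+1 %% k) || (i == j.+1 %% k)).
Definition union_rel k a b : rel nat := fun i j =>
  if i < k then (j < k) && a i j else (k <= j) && b (i - k) (j - k).
Definition compl_rel a : rel nat := fun i j => (i != j) && ~~ a i j.

Lemma represents_empty : represents (empty_graph n) empty_rel.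
Proof. by move=> i j; rewrite /adj inE. Qed.

Lemma represents_complete : represents (complete_graph n) complete_rel.
Proof.
by move=> i j; rewrite /adj inE cards2 /complete_rel val_eqE; case: (i == j).
Qed.

Lemma represents_compl (G : graph 'I_n) a :
  represents G a -> represents (compl G) (compl_rel a).
Proof. by move=> Ga i j; rewrite adj_compl Ga. Qed.

Lemma represents_path : represents (path_graph n) path_rel.
Proof.
move=> i j; rewrite /adj inE; apply/existsP/orP => [[u /existsP[v]]|[] ij].
- by case/andP=> uv /eqP/eq_set2[[-> ->]|[-> ->]]; [left|right].
- by exists i; apply/existsP; exists j; rewrite ij eqxx.
- by exists j; apply/existsP; exists i; rewrite ij setUC eqxx.
Qed.

Lemma represents_cycle : represents (cycle_graph n) (cycle_rel n).
Proof.
move=> i j; rewrite /cycle_rel; apply/imsetP/idP => [[u]|].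
  rewrite inE => nu /eq_set2[[-> ->]|[-> ->]]; rewrite eqxx ?orbT andbT //.
  by rewrite eq_sym.
case/andP=> nij /orP[] ij.
  have e : j = ordS i by apply/val_inj/eqP.
  by exists i; rewrite ?inE -e.
have e : i = ordS j by apply/val_inj/eqP.
by exists j; rewrite ?inE -e 1?setUC // eq_sym.
Qed.

Lemma represents_union (G : graph 'I_m) (H : graph 'I_n) a b :
  represents G a -> represents H b ->
  represents (disjoint_union G H) (union_rel m a b).
Proof.
move=> Ga Hb i j; rewrite /adj inE /union_rel.
apply/orP/idP => [[]/imsetP[e eE]|].
- have /cards2P[x [y [_ exy]]] := edges_card2 eE; move: eE; rewrite {}exy.
  rewrite imsetU !imset_set1 => xyE.
  case/eq_set2=> [[-> ->]|[-> ->]] /=; rewrite !ltn_ord /= -Ga //.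
  by rewrite adjC.
- have /cards2P[x [y [_ exy]]] := edges_card2 eE; move: eE; rewrite {}exy.
  rewrite imsetU !imset_set1 => xyE.
  case/eq_set2=> [[-> ->]|[-> ->]] /=;
    rewrite ltnNge !leq_addr /= !addKn -Hb //.
  by rewrite adjC.
case: (split_ordP i) => u ->; case: (split_ordP j) => v -> /=;
  rewrite ?ltn_ord /= ?(ltnNge (m + _)) ?leq_addr //=.
- rewrite -Ga => uv; left; apply/imsetP; exists [set u; v] => //.
  by rewrite imsetU !imset_set1.
- by rewrite leqNgt ltn_ord.
- rewrite !addKn -Hb => uv; right; apply/imsetP; exists [set u; v] => //.
  by rewrite imsetU !imset_set1.
Qed.

End SmallGraphs.

Definition pad_rel k a := union_rel k a empty_rel.

Lemma represents_pad n k (G : graph 'I_k) a :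
  represents G a -> represents (pad n G) (pad_rel k a).
Proof. by move=> Ga; apply: represents_union => //; apply: represents_empty. Qed.

Definition listed_rels : seq (rel nat) :=
  [:: complete_rel; empty_rel;
      pad_rel 2 path_rel; compl_rel (pad_rel 2 path_rel);
      pad_rel 4 (union_rel 2 path_rel path_rel); pad_rel 5 (cycle_rel 5);
      pad_rel 3 path_rel; pad_rel 3 complete_rel;
      pad_rel 5 (union_rel 3 path_rel path_rel); pad_rel 4 path_rel;
      union_rel 3 path_rel path_rel; compl_rel (pad_rel 3 path_rel);
      pad_rel 4 (cycle_rel 4); pad_rel 5 path_rel; path_rel; cycle_rel 6].

Lemma represents_listed (k : 'I_16) :
  represents (tnth listed_graphs k) (nth empty_rel listed_rels k).
Proof.
rewrite (tnth_nth (empty_graph 6)).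
(* The sizes are supplied by hand: the type ['I_6] shows only their sum, up to conversion. *)
case: k => k /=; do 16![case: k => [_|k] /=;
  first by do ?[ exact: represents_complete | exact: represents_empty
               | exact: represents_path | exact: represents_cycle
               | apply: (@represents_compl 6)
               | apply: (@represents_pad 6 2) | apply: (@represents_pad 6 3)
               | apply: (@represents_pad 6 4) | apply: (@represents_pad 6 5)
               | apply: (@represents_union 2 2) | apply: (@represents_union 3 2)
               | apply: (@represents_union 3 3) ]].
by [].
Qed.

(** * Codes of switching classes and their orbits *)

Definition pairs5 := [seq (i, j) | j <- iota 0 5, i <- iota 0 j].

(** The fixed vertex is 5, the value of [ord_max] in ['I_6]; the ten bits belong to the pairs among
    the other five vertices. *)
Definition code (a : rel nat) := [seq triple a ij.1 ij.2 5 | ij <- pairs5].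

Definition relabel (p : seq nat) (a : rel nat) : rel nat :=
  fun i j => a (nth 0 p i) (nth 0 p j).

(** Removing duplicates from the 720 codes keeps the later membership tests short. *)
Definition code_orbit (a : rel nat) :=
  undup [seq code (relabel p a) | p <- permutations (iota 0 6)].

Lemma mem_pairs5 i j : ((i, j) \in pairs5) = (i < j < 5).
Proof.
apply/allpairsPdep/idP => [[v [u [+ + [-> ->]]]]|/andP[ij j5]].
  by rewrite !mem_iota /= !add0n => -> ->.
by exists j, i; rewrite !mem_iota.
Qed.

(** The pairs [i < j < 5] suffice: the parity is symmetric in its first two arguments and vanishes
    when two of the three vertices coincide. *)
Lemma eq_codeP (G H : graph 'I_6) (a b : rel nat) (f : 'I_6 -> 'I_6) :
    represents G a -> (forall i j : 'I_6, b i j = adj H (f i) (f j)) ->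
  code a = code b <->
  (forall i j : 'I_6, triple (adj H) (f i) (f j) (f ord_max)
                      = triple (adj G) i j ord_max).
Proof.
move=> Ga bE.
have tri (i j : 'I_6) : (triple b i j 5 = triple (adj H) (f i) (f j) (f ord_max))
    * (triple a i j 5 = triple (adj G) i j ord_max).
  by rewrite /triple !(bE _ ord_max) !bE !Ga.
split=> [/eq_in_map ab i j|ab].
- have lt5 (u v : 'I_6) : u < v ->
      triple (adj H) (f u) (f v) (f ord_max) = triple (adj G) u v ord_max.
    move=> uv; have [v5|v5] := ltnP v 5.
      by rewrite -!tri; have /= -> := ab (val u, val v) _; rewrite // mem_pairs5 uv.
    have -> : v = ord_max by apply/val_inj/eqP; rewrite /= eqn_leq v5 -ltnS ltn_ord.
    by rewrite /triple !adjxx !addbb.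
  have tC (T : finType) (K : graph T) x y z :
      triple (adj K) x y z = triple (adj K) y x z.
    by rewrite /triple (adjC K x y) -!addbA (addbC (adj K x z)).
  case: (ltngtP i j) => [/lt5//|/lt5 ji|/val_inj->]; first by rewrite tC ji tC.
  by rewrite /triple !adjxx /= !addbb.
- apply/eq_in_map => -[i j]; rewrite mem_pairs5 => /andP[ij j5] /=.
  have j6 : j < 6 by apply: ltnW.
  by have := tri (Ordinal (ltn_trans ij j6)) (Ordinal j6); rewrite ab => -[-> ->].
Qed.

(** A permutation [p] of [iota 0 6] is the list of values of a bijection [f], and [relabel p b] is
    then the adjacency of [H] along [f]. Equal codes give equal parities through [ord_max], hence a
    switching set, and conversely. *)
Lemma code_orbitP (G H : graph 'I_6) (a b : rel nat) :
    represents G a -> represents H b ->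
  reflect (switch_iso G H) (code a \in code_orbit b).
Proof.
move=> Ga Hb; rewrite mem_undup.
apply: (iffP mapP) => [[p]|[f [bf sf]]].
- rewrite mem_permutations => pp /esym ab.
  have sp : size p = 6 by rewrite (perm_size pp).
  have p6 i : i < 6 -> nth 0 p i < 6.
    move=> i6; have := mem_nth 0 (_ : i < size p).
    by rewrite sp => /(_ i6); rewrite (perm_mem pp) mem_iota.
  pose f (i : 'I_6) := Ordinal (p6 i (ltn_ord i)).
  exists f; split.
    apply/injF_bij => i j /(congr1 val)/= /eqP.
    by rewrite nth_uniq ?sp // ?(perm_uniq pp) ?iota_uniq // => /eqP/val_inj.
  apply: (@switch_of_triple _ _ _ _ _ ord_max).
  by apply: (iffLR (eq_codeP (f := f) Ga _) (esym ab)) => i j; rewrite Hb.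
- pose p := [seq val (f i) | i <- enum 'I_6].
  have pE (i : 'I_6) : nth 0 p i = f i.
    by rewrite (nth_map ord0) ?size_enum_ord // nth_ord_enum.
  exists p.
    rewrite mem_permutations uniq_perm ?iota_uniq //.
      rewrite map_inj_uniq ?enum_uniq // => i j /val_inj.
      exact: bij_inj bf _ _.
    move=> i; rewrite mem_iota /= add0n; apply/mapP/idP => [[j _ ->]|i6]; first exact: ltn_ord.
    case: bf => g _ gK; exists (g (Ordinal i6)); rewrite ?mem_enum //.
    by rewrite gK.
  have bE (i j : 'I_6) : relabel p b i j = adj H (f i) (f j).
    by rewrite /relabel !pE Hb.
  by apply/(eq_codeP Ga bE) => i j; apply: triple_switch sf _ _ _.
Qed.

(** * Enumeration of the 1024 codes *)

Fixpoint bitseqs n : seq bitseq :=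
  if n is n'.+1 then [seq b :: s | b <- [:: false; true], s <- bitseqs n']
  else [:: [::]].

Lemma mem_bitseqs (s : bitseq) : s \in bitseqs (size s).
Proof.
elim: s => //= b s IH; rewrite cats0 mem_cat.
by case: b; rewrite (map_f (cons _)) ?orbT.
Qed.

Definition orbits_cover (os : seq (seq bitseq)) :=
  all (fun c => has (fun o : seq bitseq => c \in o) os) (bitseqs 10).

(** Testing one code per listed graph is enough, because by [code_orbitP] its membership in an orbit
    already decides equivalence. *)
Definition orbits_separate (os : seq (seq bitseq)) :=
  all (fun j => all (fun k =>
    (code (nth empty_rel listed_rels j) \in nth [::] os k) ==> (j == k))
      (iota 0 16)) (iota 0 16).

(* A single statement, so that the orbits are enumerated only once. *)
Lemma listed_orbits_partition :
  let os := map code_orbit listed_rels in orbits_cover os && orbits_separate os.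
Proof. by vm_compute. Qed.

Lemma switch_iso_listed (G : graph 'I_6) :
  exists k : 'I_16, switch_iso G (tnth listed_graphs k).
Proof.
(* Arguments above 5 get a default value from [inord], but [represents] only looks at those below
   6. *)
pose a : rel nat := fun i j => adj G (inord i) (inord j).
have Ga : represents G a by move=> i j; rewrite /a !inord_val.
have /andP[/allP/(_ (code a) (mem_bitseqs _)) + _] := listed_orbits_partition.
rewrite has_map => /(has_nthP empty_rel)[k k16 /= ck].
exists (Ordinal k16); apply/(code_orbitP Ga (represents_listed _)).
exact: ck.
Qed.

Lemma listed_switch_iso_inj (j k : 'I_16) :
  switch_iso (tnth listed_graphs j) (tnth listed_graphs k) -> j = k.
Proof.
move/(code_orbitP (represents_listed j) (represents_listed k)) => cjk.
have /andP[_ /allP/(_ (val j))] := listed_orbits_partition.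
rewrite mem_iota ltn_ord => /(_ isT)/allP/(_ (val k)).
rewrite mem_iota ltn_ord => /(_ isT)/implyP.
have k16 : k < size listed_rels := ltn_ord k.
by rewrite (nth_map empty_rel) // => /(_ cjk)/eqP/val_inj.
Qed.

(** * Counting the classes *)

(** [equivalence_partition] takes a boolean relation, so the two existentials range over finite
    types here. *)
Definition switch_isob (X : finType) : rel (graph X) := fun G H =>
  [exists f : {ffun X -> X}, exists A : {set X}, injectiveb f &&
    [forall x, forall y,
       adj H (f x) (f y) == adj G x y (+) ((x \in A) (+) (y \in A))]].

Lemma switch_isoP (X : finType) (G H : graph X) :
  reflect (switch_iso G H) (switch_isob G H).
Proof.
apply: (iffP existsP) => [[f /existsP[A /andP[/injectiveP fi fP]]]|].
  exists f; split; first exact: injF_bij.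
  by exists A => x y; apply/eqP; move/forallP/(_ x)/forallP/(_ y): fP.
case=> f [bf [A fP]]; exists (finfun f); apply/existsP; exists A.
apply/andP; split.
  by apply/injectiveP => x y; rewrite !ffunE => /(bij_inj bf).
by apply/forallP => x; apply/forallP => y; rewrite !ffunE fP.
Qed.

(** Sending [i] to the class of [g i] is onto the partition by the covering hypothesis and injective
    by the separation hypothesis. *)
Lemma card_equivalence_partition (T I : finType) (r : rel T) (g : I -> T) :
    symmetric r -> transitive r ->
    (forall x, exists i, r x (g i)) -> (forall i j, r (g i) (g j) -> i = j) ->
  #|equivalence_partition r [set: T]| = #|I|.
Proof.
move=> rC rT cover sep.
(* Reflexivity comes from going to a representative and back. *)
have rr x : r x x by have [i ri] := cover x; apply: rT (ri) _; rewrite rC.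
pose c x := [set y in [set: T] | r x y].
have cE x y : r x y -> c x = c y.
  move=> xy; apply/setP => z; rewrite !inE /=.
  by apply/idP/idP; apply: rT; rewrite // rC.
have -> : equivalence_partition r [set: T] = [set c (g i) | i in I].
  apply/setP => B; apply/imsetP/imsetP => [[x _ ->]|[i _ ->]].
    by have [i /cE xi] := cover x; exists i.
  by exists (g i).
rewrite card_imset // => i j /setP/(_ (g j)); rewrite !inE /= rr.
exact: sep.
Qed.

(** * Transfer to an arbitrary six-element set *)

Theorem theorem2p3 (X : finType) (hX : #|X| = 6) :
  (exists g : 'I_16 -> graph X,
     forall k : 'I_16, isomorphic (g k) (tnth listed_graphs k)) /\
  (forall g : 'I_16 -> graph X,
     (forall k : 'I_16, isomorphic (g k) (tnth listed_graphs k)) ->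
     (forall G : graph X, exists k : 'I_16, sim G (g k)) /\
     (forall j k : 'I_16, j <> k -> ~ sim (g j) (g k))) /\
  (exists r : rel (graph X),
     (forall G H : graph X, r G H <-> sim G H) /\
     reflexive r /\ symmetric r /\ transitive r /\
     #|equivalence_partition r [set: graph X]| = 16).
Proof.
have [h bh] : exists h : X -> 'I_6, bijective h.
  exists (cast_ord hX \o enum_rank).
  apply: bij_comp; last exact: enum_rank_bij.
  by exists (cast_ord (esym hX)); [apply: cast_ordK|apply: cast_ordKV].
have [h' bh'] : exists h' : 'I_6 -> X, bijective h'.
  by case: bh => h' hK h'K; exists h', h.
have [g0 g0P] : exists g : 'I_16 -> graph X,
    forall k : 'I_16, isomorphic (g k) (tnth listed_graphs k).
  have [g gP] := fin_all_exists (fun k : 'I_16 =>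
    isomorphic_pullback (tnth listed_graphs k) bh).
  by exists g.
have main (g : 'I_16 -> graph X) :
    (forall k, isomorphic (g k) (tnth listed_graphs k)) ->
    (forall G : graph X, exists k, switch_iso G (g k)) /\
    (forall j k, switch_iso (g j) (g k) -> j = k).
  move=> gP; have {}gP k := isomorphic_switch_iso (gP k); split=> [G|j k jk].
    (* [G'] is a copy of [G] on ['I_6], where the enumeration applies; the result returns to [X]
       through the isomorphism of [g k] with the listed graph. *)
    have [G' /isomorphic_switch_iso GG'] := isomorphic_pullback G bh'.
    have [k G'k] := switch_iso_listed G'; exists k.
    apply: switch_iso_trans (switch_iso_sym GG') _.
    exact: switch_iso_trans G'k (switch_iso_sym (gP k)).
  apply: listed_switch_iso_inj.
  apply: switch_iso_trans (switch_iso_sym (gP j)) _.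
  exact: switch_iso_trans jk (gP k).
split; first by exists g0.
split=> [g /main[cover sep]|].
  split=> [G|j k jk /simE/sep//].
  by have [k Gk] := cover G; exists k; apply/simE.
have [cover sep] := main _ g0P.
have rC : symmetric (@switch_isob X).
  by move=> G H; apply/switch_isoP/switch_isoP; apply: switch_iso_sym.
have rT : transitive (@switch_isob X).
  by move=> H G K /switch_isoP GH /switch_isoP HK; apply/switch_isoP;
     apply: switch_iso_trans HK.
exists (@switch_isob X); split.
  by move=> G H; split=> [/switch_isoP/simE|/simE/switch_isoP].
do 3?split=> //; first by move=> G; apply/switch_isoP/switch_iso_refl.
rewrite -[RHS]card_ord; apply: (card_equivalence_partition (g := g0)) => //.
  by move=> G; have [k Gk] := cover G; exists k; apply/switch_isoP.
by move=> j k /switch_isoP/sep.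
Qed.
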